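(* Let $N\in\mathbb{N}$, $\lambda\in(0,1]$, $\rho\in(0,1)$, $\alpha\in\mathbb{R}$, and let $\mathcal{K}(t,s)=\lambda^{t+s}\rho^{|t-s|}$ be the DC kernel. Let the input be $u(t)=e^{-\alpha t}$ for $t\ge0$ and $u(t)=0$ for $t<0$. Put $T=\log(\lambda\rho)+\alpha$ and $D=\log(\lambda/\rho)+\alpha$, and assume $T\ne0$ and $D\neq0$. (CT case) Let $0\le t_1<\cdots<t_N$ be real numbers, and let $\Psi\in\mathbb{R}^{N\times N}$ have entries $$\Psi(i,j)=\int_0^\infty\!\!\int_0^\infty\mathcal{K}(s,r)\,u(t_i-s)\,u(t_j-r)\,dr\,ds .$$ Then $\Psi\in\mathcal{S}_{N,2}$, and it has the Givens-vector representation $$\boldsymbol c_i^T=\begin{bmatrix}\dfrac{|(\lambda\rho)^{t_i}-e^{-\alpha t_i}|}{\sqrt{\sum_{j=i}^N[(\lambda\rho)^{t_j}-e^{-\alpha t_j}]^2}} & \dfrac{e^{-\alpha t_i}}{\sqrt{\sum_{j=i}^Ne^{-2\alpha t_j}}}\end{bmatrix},$$ $$\boldsymbol s_i^T=\begin{bmatrix}\dfrac{\sqrt{\sum_{j=i+1}^N[(\lambda\rho)^{t_j}-e^{-\alpha t_j}]^2}}{\sqrt{\sum_{j=i}^N[(\lambda\rho)^{t_j}-e^{-\alpha t_j}]^2}} & \dfrac{\sqrt{\sum_{j=i+1}^Ne^{-2\alpha t_j}}}{\sqrt{\sum_{j=i}^Ne^{-2\alpha t_j}}}\end{bmatrix}$$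 for $i=1,\dots,N-1$, and, for $i=1,\dots,N$, $$\hat\nu_{i,1}=\frac{|(\lambda/\rho)^{t_i}-e^{-\alpha t_i}|\sqrt{\sum_{j=i}^N[(\lambda\rho)^{t_j}-e^{-\alpha t_j}]^2}}{|DT|},$$ $$\hat\nu_{i,2}=\frac{(\lambda/\rho)^{t_i}-(\lambda\rho)^{t_i}+C(\lambda^{2t_i}e^{\alpha t_i}-e^{-\alpha t_i})}{DT}\sqrt{\sum_{j=i}^Ne^{-2\alpha t_j}},$$ where $C=\log\rho/(\log\lambda+\alpha)$. (DT case) Let $t_i=i$ for $i=1,\dots,N$, and let $\Psi\in\mathbb{R}^{N\times N}$ have entries $$\Psi(i,j)=\sum_{s=0}^\infty\sum_{r=0}^\infty\mathcal{K}(s,r)\,u(t_i-s)\,u(t_j-r).$$ Then $\Psi\in\mathcal{S}_{N,2}$, and it has the Givens-vector representation $$\boldsymbol c_i^T=\begin{bmatrix}\dfrac{|e^{-\alpha t_i}-(\lambda\rho)^{t_i}e^{T}|}{\sqrt{\sum_{j=i}^N[e^{-\alpha t_j}-(\lambda\rho)^{t_j}e^{T}]^2}} & \dfrac{e^{-\alpha t_i}}{\sqrt{\sum_{j=i}^Ne^{-2\alpha t_j}}}\end{bmatrix},$$ $$\boldsymbol s_i^T=\begin{bmatrix}\dfrac{\sqrt{\sum_{j=i+1}^N[e^{-\alpha t_j}-(\lambda\rho)^{t_j}e^{T}]^2}}{\sqrt{\sum_{j=i}^N[e^{-\alpha t_j}-(\lambda\rho)^{t_j}e^{T}]^2}} &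 \dfrac{\sqrt{\sum_{j=i+1}^Ne^{-2\alpha t_j}}}{\sqrt{\sum_{j=i}^Ne^{-2\alpha t_j}}}\end{bmatrix}$$ for $i=1,\dots,N-1$, and, for $i=1,\dots,N$, $$\hat\nu_{i,1}=\frac{|e^{-\alpha t_i}-(\lambda/\rho)^{t_i}e^{D}|\sqrt{\sum_{j=i}^N[e^{-\alpha t_j}-(\lambda\rho)^{t_j}e^{T}]^2}}{|D'T'|},$$ $$\hat\nu_{i,2}=\frac{e^{D}(\lambda/\rho)^{t_i}-e^{T}(\lambda\rho)^{t_i}+C'(e^{D+T}\lambda^{2t_i}e^{\alpha t_i}-e^{-\alpha t_i})}{D'T'}\sqrt{\sum_{j=i}^Ne^{-2\alpha t_j}},$$ where $T'=1-e^{T}$, $D'=1-e^{D}$ and $C'=(e^{D}-e^{T})/(1-e^{D+T})$.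
   Context: CT and DT mean continuous time and discrete time. The matrix $\Psi$ is called the output kernel matrix. Definition of $\mathcal{S}_{N,p}$: a symmetric matrix $A\in\mathbb{R}^{N\times N}$ is $p$-semiseparable ($A\in\mathcal{S}_{N,p}$) if $\operatorname{rank}(A(i:N,1:i))\le p$ for all $i=1,\dots,N$, with equality $\operatorname{rank}(A(i:N,1:i))=p$ for at least one $i$. Here $A(i:N,1:i)$ is the submatrix of rows $i,\dots,N$ and columns $1,\dots,i$. Givens-vector representation (GvR): vectors $\boldsymbol c_i,\boldsymbol s_i,\hat{\boldsymbol\nu}_i\in\mathbb{R}^p$ ($i=1,\dots,N$), with components $c_{i,k},s_{i,k},\hat\nu_{i,k}$, form a GvR of a symmetric $A\in\mathbb{R}^{N\times N}$ if $c_{i,k}^2+s_{i,k}^2=1$ for all $i\le N-1$ and $k\le p$, and, with $S_i=\operatorname{diag}(\boldsymbol s_i)\in\mathbb{R}^{p\times p}$, $$A(i,j)=\boldsymbol c_i^T\,S_{i-1}S_{i-2}\cdots S_j\,\hat{\boldsymbol\nu}_j\quad\text{for }1\le j\le i\le N,$$ where the product is $I_p$ when $i=j$ (the entries above the diagonal are given by symmetry). By convention $c_{N,k}=1$ and $s_{N,k}=0$ for all $k$, so $\boldsymbol c_i,\boldsymbol s_i$ need only be specified for $i\le N-1$.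
   Formalization: Membership in S_{N,2} is asserted only when at least three t_i are positive (else it is impossible, and only symmetry and all ranks ≤ 2 are asserted); the Givens-vector representations are asserted only when log λ + α ≠ 0, so that C and C' are defined. *)

(* Defs.v *)
From HB Require Import structures.
From mathcomp Require Import all_boot all_order all_algebra.
From mathcomp Require Import all_classical all_reals all_analysis.
Import Order.TTheory GRing.Theory Num.Theory.
Import numFieldNormedType.Exports.

Set Implicit Arguments.
Unset Strict Implicit.
Unset Printing Implicit Defensive.

Local Open Scope classical_set_scope.
Local Open Scope ring_scope.

Section Semiseparable.
Variables (R : realType) (N : nat).
Implicit Type A : 'M[R]_N.

(* Indices are 0-based: for i : 'I_N this is A(i+1:N, 1:i+1) in the usual
   1-based notation, a block with N - i rows and i + 1 columns. *)
Definition lower_block A (i : 'I_N) : 'M[R]_(N - i, i.+1) :=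
  mxsub (fun k : 'I_(N - i) =>
           cast_ord (subnKC (ltnW (ltn_ord i))) (rshift i k))
        (fun l : 'I_i.+1 => widen_ord (ltn_ord i) l) A.

Definition semiseparable_le (p : nat) A :=
  A^T = A /\ forall i, (\rank (lower_block A i) <= p)%N.

(* Since lower_block A i has N - i rows and i + 1 columns, this can only hold
   when 2 * p <= N + 1. *)
Definition semiseparable (p : nat) A :=
  semiseparable_le p A /\ exists i, \rank (lower_block A i) = p.

(* The convention for the last index: v is only read at the first N - 1
   indices, and the last vector is constantly d. *)
Definition with_last (p : nat) (d : R) (v : 'I_N -> 'cV[R]_p) (i : 'I_N) :
    'cV[R]_p :=
  if (i.+1 < N)%N then v i else const_mx d.

(* The enumeration is reversed so that the product is S_(i-1) ... S_j. *)
Definition is_GvR (p : nat) A (c0 s0 nu : 'I_N -> 'cV[R]_p) :=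
  let c := with_last 1 c0 in
  let s := with_last 0 s0 in
  [/\ A^T = A,
      forall i : 'I_N, (i.+1 < N)%N ->
        forall k, c i k 0 ^+ 2 + s i k 0 ^+ 2 = 1
    & forall i j : 'I_N, (j <= i)%N ->
        A i j = ((c i)^T
          *m (\big[mulmx/1%:M]_(k <- rev (enum 'I_N) | (j <= k < i)%N)
                diag_mx (s k)^T)
          *m nu j) 0 0].

Definition tail_sum (f : 'I_N -> R) (m : nat) : R :=
  \sum_(j < N | (m <= j)%N) f j.

End Semiseparable.

Definition vec2 (R : realType) (a b : R) : 'cV[R]_2 :=
  \col_(k < 2) [:: a; b]`_k.

Section OutputKernel.
Variable R : realType.

Definition dc_kernel (lambda rho t s : R) : R :=
  lambda `^ (t + s) * rho `^ `|t - s|.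

Definition exp_input (alpha t : R) : R :=
  if 0 <= t then expR (- alpha * t) else 0.

Definition output_kernel_ct (K : R -> R -> R) (u : R -> R) (N : nat)
    (t : 'I_N -> R) : 'M[R]_N :=
  \matrix_(i, j)
    \int[@lebesgue_measure R]_(s in `[0, +oo[)
      \int[@lebesgue_measure R]_(r in `[0, +oo[)
        (K s r * u (t i - s) * u (t j - r)).

Definition output_kernel_dt (K : R -> R -> R) (u : R -> R) (N : nat)
    (t : 'I_N -> R) : 'M[R]_N :=
  \matrix_(i, j)
    \big[+%R/0]_(0 <= s <oo) \big[+%R/0]_(0 <= r <oo)
      (K s%:R r%:R * u (t i - s%:R) * u (t j - r%:R)).

End OutputKernel.

(* Main.v *)
(* With T and D as in the theorem, the kernel times the two inputs is
   e^(-alpha x) e^(-alpha y) e^(T max(s,r) + D min(s,r)), up to truncation to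
   s <= x and r <= y.  Hence, for t_j <= t_i,
     Psi(i,j) = e_i e_j (f_i h_j + g_j),   e_i = e^(-alpha t_i),
   where f and h are the integrals from 0 of e^(Ts) and e^(Ds) (CT) or the
   corresponding geometric sums (DT), and g is the integral of f'h - h'f (CT) or
   the sum of its discrete analogue (DT).  This writes the lower part of Psi
   with two generators, which bounds the ranks by 2, and the Givens-vector form
   is obtained from it because the product of the sines telescopes.  Rank 2 is
   reached since f is strictly monotone and g is not proportional to h. *)

Require Import Defs.
From mathcomp Require Import all_boot all_order all_algebra.
From mathcomp Require Import all_classical all_reals all_analysis.
From mathcomp Require Import zify ring lra.
Import Order.TTheory GRing.Theory Num.Theory.
Import numFieldNormedType.Exports.
Local Open Scope ring_scope.

Set Implicit Arguments.
Unset Strict Implicit.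
Unset Printing Implicit Defensive.

(** * Rank bounds for the lower blocks of a matrix *)

Section LinearAlgebra.
Variables (R : realType) (N : nat).
Implicit Types (A : 'M[R]_N) (i j : 'I_N).

(** The submatrix on the chosen rows and columns is [B] multiplied on both sides by selection
    matrices, so its rank, which is 2, bounds that of [B] from below. *)
Lemma minor2_rank_ge2 m n (B : 'M[R]_(m, n)) (i1 i2 : 'I_m) (j1 j2 : 'I_n) :
  B i1 j1 * B i2 j2 - B i1 j2 * B i2 j1 != 0 -> (2 <= \rank B)%N.
Proof.
move=> nz.
pose f (k : 'I_2) := if k == 0 then i1 else i2.
pose g (k : 'I_2) := if k == 0 then j1 else j2.
have du : mxsub f g B \in unitmx.
  rewrite unitmxE unitfE (expand_det_row _ ord0) !big_ord_recl big_ord0.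
  rewrite /cofactor !det_mx11 !mxE /= addr0 expr0 mul1r expr1 mulN1r mulrN.
  by rewrite /f /g /=.
have BE : mxsub f g B = rowsub f 1%:M *m B *m colsub g 1%:M.
  by rewrite -rowsubE mulmx_colsub mulmx1; apply/matrixP => k l; rewrite !mxE.
rewrite -[X in (X <= _)%N](mxrank_unit du) BE.
exact: leq_trans (mxrankM_maxl _ _) (mxrankM_maxr _ _).
Qed.

(** Every entry of a lower block lies on or below the diagonal, so the two-term formula holds on the
    whole block and factors it through dimension 2. *)
Lemma lower_block_generators_le2 A (u v g h : 'I_N -> R) :
  (forall i j, (j <= i)%N -> A i j = u i * g j + v i * h j) ->
  forall i, (\rank (lower_block A i) <= 2)%N.
Proof.
move=> AE i.
pose r (k : 'I_(N - i)) := cast_ord (subnKC (ltnW (ltn_ord i))) (rshift i k).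
pose w (l : 'I_i.+1) := widen_ord (ltn_ord i) l.
have -> : lower_block A i =
    (\matrix_(k < N - i, a < 2) (if a == 0 then u (r k) else v (r k))) *m
    (\matrix_(a < 2, l < i.+1) (if a == 0 then g (w l) else h (w l))).
  apply/matrixP => k l; rewrite !mxE big_ord_recl big_ord1 !mxE /= AE //=.
  by rewrite (leq_trans (leq_ord l)) ?leq_addr.
exact: leq_trans (mxrankM_maxl _ _) (rank_leq_col _).
Qed.

(** The block at [i1] contains rows [i1], [i2] and columns [i0], [i1]; the minor they form touches
    the diagonal but no entry above it. *)
Lemma lower_block_minor2_ge2 A (i0 i1 i2 : 'I_N) :
  (i0 < i1)%N -> (i1 < i2)%N ->
  A i1 i0 * A i2 i1 - A i1 i1 * A i2 i0 != 0 ->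
  (2 <= \rank (lower_block A i1))%N.
Proof.
move=> lt01 lt12.
have k1P : (0 < N - i1)%N by rewrite subn_gt0.
have k2P : (i2 - i1 < N - i1)%N by rewrite ltn_sub2r.
have l0P : (i0 < i1.+1)%N by rewrite ltnS ltnW.
set B := lower_block A i1.
have B1 l : B (Ordinal k1P) l = A i1 (widen_ord (ltn_ord i1) l).
  by rewrite mxE; congr (A _ _); apply: val_inj; rewrite /= addn0.
have B2 l : B (Ordinal k2P) l = A i2 (widen_ord (ltn_ord i1) l).
  by rewrite mxE; congr (A _ _); apply: val_inj; rewrite /= subnKC // ltnW.
have w0 : widen_ord (ltn_ord i1) (Ordinal l0P) = i0 by apply: val_inj.
have w1 : widen_ord (ltn_ord i1) ord_max = i1 by apply: val_inj.
move=> nz; apply: (@minor2_rank_ge2 _ _ _ (Ordinal k1P) (Ordinal k2P)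
  (Ordinal l0P) ord_max).
by rewrite !B1 !B2 w0 w1.
Qed.

End LinearAlgebra.

(** * From two generators to a Givens-vector representation *)

Section GivensVector.
Variables (R : realType) (N : nat).
Implicit Types (A : 'M[R]_N) (i j : 'I_N).

Lemma big_mulmx_diag p (I : Type) (r : seq I) (P : pred I) (v : I -> 'cV[R]_p) :
  \big[mulmx/1%:M]_(k <- r | P k) diag_mx (v k)^T =
  diag_mx (\row_a \prod_(k <- r | P k) v k a 0).
Proof.
elim: r => [|k r IH].
  apply/matrixP => a b; rewrite big_nil !mxE big_nil.
  by case: eqP.
rewrite big_cons IH; case: ifP => Pk; last first.
  by congr diag_mx; apply/rowP => a; rewrite !mxE big_cons Pk.
rewrite mulmx_diag; congr diag_mx; apply/rowP => a.
by rewrite !mxE big_cons Pk.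
Qed.

Lemma tail_sumS (f : 'I_N -> R) i : tail_sum f i = f i + tail_sum f i.+1.
Proof.
rewrite /tail_sum (bigD1 i) //=; congr (_ + _).
by apply: eq_bigl => j; rewrite ltn_neqAle andbC eq_sym.
Qed.

Lemma tail_sum_out (f : 'I_N -> R) : tail_sum f N = 0.
Proof. by rewrite /tail_sum big1 // => j; rewrite leqNgt ltn_ord. Qed.

Lemma tail_sum_sqr_gt0 (f : 'I_N -> R) i k :
  (k <= i)%N -> f i != 0 -> 0 < tail_sum (fun j => f j ^+ 2) k.
Proof.
move=> ki nz; rewrite /tail_sum (bigD1 i) //=.
rewrite ltr_pwDl ?exprn_even_gt0 // sumr_ge0 // => j _; exact: sqr_ge0.
Qed.

Lemma tail_sum_sqr_ge0 (f : 'I_N -> R) k : 0 <= tail_sum (fun j => f j ^+ 2) k.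
Proof. by apply: sumr_ge0 => j _; apply: sqr_ge0. Qed.

(* The product of the sines telescopes, and at the last index, where the
   cosine is 1 by convention, the tail sum has a single term. *)
Lemma GvR_component (m : 'I_N -> R) i j :
  let M := tail_sum (fun k => m k ^+ 2) in
  (forall k : 'I_N, (0 < k)%N -> m k != 0) -> (j <= i)%N ->
  (if (i.+1 < N)%N then `|m i| / Num.sqrt (M i) else 1) *
  (\prod_(k < N | (j <= k < i)%N) (Num.sqrt (M k.+1) / Num.sqrt (M k))) *
  Num.sqrt (M j) = `|m i|.
Proof.
move=> M m0 ji.
(* Since [m] may vanish at index 0, positivity of [M k] is drawn from its term at [k.+1]. *)
have M0 k : (k.+1 < N)%N -> Num.sqrt (M k) != 0.
  move=> kN; rewrite gt_eqF // sqrtr_gt0.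
  by apply: (@tail_sum_sqr_gt0 m (Ordinal kN)); [exact: leqnSn | exact: m0].
rewrite -mulrA; have -> : \prod_(k < N | (j <= k < i)%N)
    (Num.sqrt (M k.+1) / Num.sqrt (M k)) =
    \prod_(j <= k < i) (Num.sqrt (M k.+1) / Num.sqrt (M k)).
  rewrite (big_nat_widen _ _ N) ?(ltnW (ltn_ord i)) // big_geq_mkord /=.
  by apply: eq_bigl => k; rewrite andbC.
have -> : \prod_(j <= k < i) (Num.sqrt (M k.+1) / Num.sqrt (M k)) *
    Num.sqrt (M j) = Num.sqrt (M i).
  move: ji; rewrite leq_eqVlt => /orP[/eqP->|lt_ji].
    by rewrite big_geq ?mul1r.
  rewrite (telescope_prodf (f := fun k => Num.sqrt (M k))) // => [|k /andP[_ ki]].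
    by rewrite divfK // M0 // (leq_ltn_trans lt_ji).
  by rewrite M0 // (leq_ltn_trans ki).
case: ltnP => iN; first by rewrite divfK ?M0.
have {}iN : i.+1 = N by apply/eqP; rewrite eqn_leq iN ltn_ord.
by rewrite mul1r /M tail_sumS iN tail_sum_out addr0 sqrtr_sqr.
Qed.

(** Each component of the representation reproduces one generator, [|m|] or [e]: the square root of
    the tail sum put into [nu] cancels what the telescoped cosines and sines leave over. Index 0 is
    exempt from [m i != 0] because a continuous sampling time may be 0 there. The squares [e2] are
    kept apart to match the exponentials with exponent [- 2 * alpha * t] in the theorem. *)
Lemma GvR_of_generators A (m n e e2 q : 'I_N -> R) (d : R) :
  let M := tail_sum (fun j => m j ^+ 2) in
  let E := tail_sum e2 in
  A^T = A ->
  (forall i, 0 < e i) -> (forall i, e2 i = e i ^+ 2) ->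
  (forall i : 'I_N, (0 < i)%N -> m i != 0) ->
  (forall i j, (j <= i)%N -> A i j = `|m i| * `|n j| / d + e i * q j) ->
  is_GvR A
    (fun i => vec2 (`|m i| / Num.sqrt (M i)) (e i / Num.sqrt (E i)))
    (fun i => vec2 (Num.sqrt (M i.+1) / Num.sqrt (M i))
                   (Num.sqrt (E i.+1) / Num.sqrt (E i)))
    (fun i => vec2 (`|n i| * Num.sqrt (M i) / d) (q i * Num.sqrt (E i))).
Proof.
move=> M E symA e0 /funext e2E m0 AE; subst e2.
have e_neq0 i : e i != 0 by rewrite gt_eqF.
split=> [//|i iN k|i j ji].
- have circle (f : 'I_N -> R) (F := tail_sum (fun j => f j ^+ 2)) :
      (forall k : 'I_N, (0 < k)%N -> f k != 0) ->
      (`|f i| / Num.sqrt (F i)) ^+ 2 +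
      (Num.sqrt (F i.+1) / Num.sqrt (F i)) ^+ 2 = 1.
    move=> f0.
    have Fi : 0 < F i.
      by apply: (@tail_sum_sqr_gt0 f (Ordinal iN)); [exact: leqnSn|exact: f0].
    rewrite !exprMn !exprVn !sqr_sqrtr ?(ltW Fi) ?tail_sum_sqr_ge0 //.
    by rewrite real_normK ?num_real // -mulrDl -tail_sumS divff // gt_eqF.
  rewrite /with_last iN /vec2 !mxE.
  case: k => -[|[|//]] /= _; first exact: circle.
  by rewrite -[e i]gtr0_norm //; apply: circle.
- rewrite AE // big_mulmx_diag -mulmxA mul_diag_mx mxE !big_ord_recl big_ord0.
  rewrite !mxE addr0.
  have GE (f g : 'I_N -> R) (F := tail_sum (fun k => f k ^+ 2)) (a : 'I_2)
      (c s : 'I_N -> 'cV[R]_2) :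
      (forall k : 'I_N, (0 < k)%N -> f k != 0) ->
      (forall k : 'I_N, c k a 0 = `|f k| / Num.sqrt (F k)) ->
      (forall k : 'I_N, s k a 0 = Num.sqrt (F k.+1) / Num.sqrt (F k)) ->
      with_last 1 c i a 0 *
      (\prod_(k <- rev (enum 'I_N) | (j <= k < i)%N) with_last 0 s k a 0 *
       (g j * Num.sqrt (F j))) = `|f i| * g j.
    move=> f0 cE sE; rewrite -(GvR_component f0 ji).
    have -> : with_last 1 c i a 0 =
        if (i.+1 < N)%N then `|f i| / Num.sqrt (F i) else 1.
      by rewrite /with_last; case: ifP => _; rewrite ?cE ?mxE.
    rewrite (perm_big (enum 'I_N)) /= ?perm_rev // big_enum_cond /=.
    under eq_bigr => k /andP[_ ki] do
      rewrite /with_last (leq_ltn_trans ki (ltn_ord i)) sE.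
    by rewrite -!mulrA [Num.sqrt _ * g j]mulrC.
  congr (_ + _); symmetry.
    rewrite /= (mulrAC `|n j|) -(mulrA `|m i|).
    by apply: (GE m (fun j => `|n j| / d)) => // k; rewrite !mxE.
  rewrite -[e i]gtr0_norm //; apply: GE => // k; rewrite !mxE /=.
    by rewrite gtr0_norm.
  by [].
Qed.
End GivensVector.

(** * Integrals over segments and over the half-line *)

Section Integrals.
Local Open Scope classical_set_scope.
Local Open Scope ring_scope.
Variable R : realType.
Notation mu := (@lebesgue_measure R).
Implicit Types (f F g : R -> R) (a b c : R).

Lemma is_derive1_continuous F g :(forall x : R, is_derive x 1 F (g x)) ->
  continuous F.
Proof.
by move=> dF x; apply/differentiable_continuous/derivable1_diffP/ex_derive.
Qed.

(** The integrands met below are piecewise, so [f] has to agree with the continuous [g] only on the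
    segment; integrability is recorded because gluing segments requires it. *)
Lemma Rintegral_FTC f F g a b : a <= b ->
  (forall x : R, is_derive x 1 F (g x)) -> continuous g ->
  (forall x, a <= x <= b -> f x = g x) ->
  mu.-integrable `[a, b] (EFin \o f) /\
  \int[mu]_(x in `[a, b]) f x = F b - F a.
Proof.
move=> ab dF cg0 fg.
have cg : {within `[a, b], continuous g} by exact: continuous_subspaceT.
split.
  have : mu.-integrable `[a, b] (EFin \o g).
    by apply: continuous_compact_integrable => //; exact: segment_compact.
  apply: eq_integrable => // x; rewrite inE /= in_itv /= => xab.
  by rewrite /= fg.
have -> : \int[mu]_(x in `[a, b]) f x = \int[mu]_(x in `[a, b]) g x.
  by apply: eq_Rintegral => x; rewrite inE /= in_itv /=; exact: fg.
move: ab; rewrite le_eqVlt => /predU1P[<-|ab].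
  by rewrite set_itv1 Rintegral_set1 subrr.
rewrite /Rintegral (@continuous_FTC2 _ g F) //.
- have cF := is_derive1_continuous dF; split => [x _||].
  + exact: ex_derive.
  + exact/cvg_at_right_filter/cF.
  + exact/cvg_at_left_filter/cF.
- by move=> x _; rewrite derive1E derive_val.
Qed.

Lemma Rintegral_itv_cat f a b c : a <= b -> b <= c ->
  mu.-integrable `[a, b] (EFin \o f) -> mu.-integrable `[b, c] (EFin \o f) ->
  mu.-integrable `[a, c] (EFin \o f) /\
  \int[mu]_(x in `[a, c]) f x =
  \int[mu]_(x in `[a, b]) f x + \int[mu]_(x in `[b, c]) f x.
Proof.
move=> ab bc iab ibc.
have acE : [set` `[a, c]] = [set` `[a, b]] `|` [set` `]b, c]].
  by rewrite -itv_bndbnd_setU // bnd_simp.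
have ibc' : mu.-integrable `]b, c] (EFin \o f).
  by apply: integrableS ibc => //; exact: subset_itv_oc_cc.
have iac : mu.-integrable `[a, c] (EFin \o f).
  have [mab oab] := integrableP _ _ _ iab; have [mbc obc] := integrableP _ _ _ ibc'.
  have mac := iffRL (measurable_funU _ (measurable_itv _) (measurable_itv _))
    (conj mab mbc).
  apply/integrableP; rewrite acE; split=> //.
  rewrite ge0_integral_setU //.
  - by rewrite lte_add_pinfty.
  - apply/measurable_funU => //; split.
    + exact: measurable_int (integrable_abse iab).
    + exact: measurable_int (integrable_abse ibc').
  - rewrite disj_set2E; apply/eqP/seteqP; split => x //=; rewrite !in_itv /=.
    by case=> /andP[_ xb] /andP[]; rewrite ltNge xb.
split => //.
have <- : \int[mu]_(x in `]b, c]) f x = \int[mu]_(x in `[b, c]) f x.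
  by rewrite Rintegral_itv_obnd_cbnd.
have := @Rintegral_itvB _ f _ _ b iac; rewrite !bnd_simp => <- //.
by rewrite addrC subrK.
Qed.

(** Used for causality: the input vanishes at negative times, which cuts each half-line integral
    down to a segment. *)
Lemma Rintegral_itv0y_trunc f b : (forall x, b < x -> f x = 0) ->
  \int[mu]_(x in `[0, +oo[) f x = \int[mu]_(x in `[0, b]) f x.
Proof.
move=> f0; rewrite Rintegral_mkcond [RHS]Rintegral_mkcond.
apply: eq_Rintegral => x _; rewrite /patch !mem_setE !in_itv /= andbT.
by case: (leP x b) => [_|/f0 ->]; rewrite ?andbT ?andbF //; case: ifP.
Qed.

End Integrals.

(** * The primitive of an exponential that vanishes at 0 *)

Section ExpPrimitive.
Variable R : realType.
Implicit Types k x : R.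

(** The case [k == 0] is kept because the exponent [T + D] used below may vanish. *)
Definition exp_prim k x : R := if k == 0 then x else (expR (k * x) - 1) / k.

Global Instance is_derive_expRM k x :
  is_derive x 1 (fun y => expR (k * y)) (k * expR (k * x)).
Proof.
have -> : (fun y => expR (k * y)) = expR \o (k \*: id) by [].
by apply: is_derive_eq; rewrite /GRing.scale /= mulr1 mulrC.
Qed.

Global Instance is_derive_exp_prim k x : is_derive x 1 (exp_prim k) (expR (k * x)).
Proof.
rewrite /exp_prim; case: eqP => [->|/eqP k0].
  by rewrite mul0r expR0; exact: is_derive_id.
have -> : (fun y => (expR (k * y) - 1) / k) =
    k^-1 \*: ((fun y => expR (k * y)) - cst 1).
  by apply/funext => y /=; rewrite mulrC.
by apply: is_derive_eq; rewrite /GRing.scale /= subr0 mulKf.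
Qed.

Lemma exp_prim0 k : exp_prim k 0 = 0.
Proof. by rewrite /exp_prim mulr0 expR0 subrr mul0r; case: ifP. Qed.

Lemma exp_primE k x : k != 0 -> exp_prim k x = (expR (k * x) - 1) / k.
Proof. by rewrite /exp_prim => /negbTE ->. Qed.

Lemma exp_prim_lt k : {homo exp_prim k : x y / x < y}.
Proof.
move=> x y xy.
have [|c _ /eqP] := MVT xy (fun z _ => is_derive_exp_prim k z).
  by apply: continuous_subspaceT;
     apply: is_derive1_continuous (is_derive_exp_prim k).
rewrite subr_eq => /eqP ->; rewrite ltrDr mulr_gt0 ?expR_gt0 //.
by rewrite subr_gt0.
Qed.

End ExpPrimitive.

(** * The double integral of the kernel in continuous time *)

Section ExpKernel.
Local Open Scope classical_set_scope.
Local Open Scope ring_scope.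
Variables (R : realType) (T D : R).
Hypotheses (T0 : T != 0) (D0 : D != 0).
Notation mu := (@lebesgue_measure R).
Implicit Types (c x y s r : R).

Definition exp_kernel s r : R :=
  if r <= s then expR (T * s + D * r) else expR (D * s + T * r).

(** This is the function g of the continuous-time case: expanding [exp_prim D] and [exp_prim T] in
    f'h - h'f leaves exponentials with exponents [T + D], [T] and [D], which are integrated term by
    term. *)
Definition exp_cross y : R :=
  (exp_prim (T + D) y - exp_prim T y) / D -
  (exp_prim (T + D) y - exp_prim D y) / T.

Lemma exp_cross0 : exp_cross 0 = 0.
Proof. by rewrite /exp_cross !exp_prim0 subrr !mul0r subrr. Qed.

Lemma is_derive_exp_cross y : is_derive y 1 exp_cross
  (expR (T * y) * exp_prim D y - expR (D * y) * exp_prim T y).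
Proof.
have -> : exp_cross = D^-1 \*: (exp_prim (T + D) - exp_prim T) -
    T^-1 \*: (exp_prim (T + D) - exp_prim D).
  by apply/funext => z /=; rewrite /exp_cross; congr (_ - _); rewrite mulrC.
apply: is_derive_eq; rewrite /GRing.scale /= !exp_primE // mulrDl expRD.
field; exact/andP.
Qed.

Lemma continuous_expRM k : continuous (fun x : R => expR (k * x)).
Proof. exact: is_derive1_continuous (is_derive_expRM k). Qed.

Lemma continuous_exp_prim k : continuous (@exp_prim R k).
Proof. exact: is_derive1_continuous (is_derive_exp_prim k). Qed.

(** This is the integral of [exp_kernel s] over [0, y]; for [s <= y] it is split at s, where the
    roles of max and min are exchanged. *)
Definition exp_kernel_section y s : R :=
  if s <= y then expR (T * s) * exp_prim D s +
    expR (D * s) * (exp_prim T y - exp_prim T s)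
  else expR (T * s) * exp_prim D y.

Lemma Rintegral_expM_segment f c k a b : a <= b ->
  (forall x, a <= x <= b -> f x = c * expR (k * x)) ->
  mu.-integrable `[a, b] (EFin \o f) /\
  \int[mu]_(x in `[a, b]) f x = c * (exp_prim k b - exp_prim k a).
Proof.
move=> ab fE; rewrite mulrBr.
apply: (@Rintegral_FTC _ f (fun x => c * exp_prim k x) _ a b ab _ _ fE) => x.
by apply: cvgM; [exact: cvg_cst|exact: continuous_expRM].
Qed.

Lemma Rintegral_exp_kernel c s y f : 0 <= s -> 0 <= y ->
  (forall r, 0 <= r <= y -> f r = c * exp_kernel s r) ->
  (forall r, y < r -> f r = 0) ->
  \int[mu]_(r in `[0, +oo[) f r = c * exp_kernel_section y s.
Proof.
move=> s0 y0 fE f0; rewrite (Rintegral_itv0y_trunc f0) /exp_kernel_section.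
have below b : b <= s -> b <= y -> 0 <= b ->
    mu.-integrable `[0, b] (EFin \o f) /\
    \int[mu]_(r in `[0, b]) f r = c * (expR (T * s) * exp_prim D b).
  move=> bs b_y b0.
  have := @Rintegral_expM_segment f (c * expR (T * s)) D 0 b b0.
  rewrite exp_prim0 subr0 -mulrA; apply => r /andP[r0 rb].
  rewrite fE ?r0 ?(le_trans rb) // /exp_kernel (le_trans rb) //.
  by rewrite expRD mulrA.
case: (leP s y) => sy; last by have [] := below y (ltW sy) (lexx y) y0.
have [i1 e1] := below s (lexx s) sy s0.
have [i2 e2] : mu.-integrable `[s, y] (EFin \o f) /\
    \int[mu]_(r in `[s, y]) f r =
    (c * expR (D * s)) * (exp_prim T y - exp_prim T s).
  apply: Rintegral_expM_segment => // r /andP[sr ry].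
  rewrite fE ?ry ?(le_trans s0) // /exp_kernel.
  case: (leP r s) => rs; last by rewrite expRD mulrA.
  (* At the common endpoint the two branches of the kernel agree. *)
  by have -> : r = s by [apply/le_anti; rewrite rs]; rewrite addrC expRD mulrA.
have [_ ->] := Rintegral_itv_cat s0 sy i1 i2.
by rewrite e1 e2; ring.
Qed.

Lemma Rintegral_exp_kernel_section c x y f : 0 <= x -> 0 <= y ->
  (forall s, 0 <= s <= x -> f s = c * exp_kernel_section y s) ->
  (forall s, x < s -> f s = 0) ->
  \int[mu]_(s in `[0, +oo[) f s =
  c * (if y <= x then exp_prim T x * exp_prim D y + exp_cross y
       else exp_prim T y * exp_prim D x + exp_cross x).
Proof.
move=> x0 y0 fE f0; rewrite (Rintegral_itv0y_trunc f0).
have below b : b <= x -> b <= y -> 0 <= b ->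
    mu.-integrable `[0, b] (EFin \o f) /\
    \int[mu]_(s in `[0, b]) f s =
    c * (exp_prim T y * exp_prim D b + exp_cross b).
  move=> bx b_y b0.
  (* In the derivative of [F], the cross term turns [expR (D * s) * exp_prim T y] into the two terms
     of the section for [s <= y]. Beyond y the section is a multiple of [expR (T * s)], and its
     integral replaces [exp_prim T y] by [exp_prim T x]. *)
  pose F s := c * (exp_prim T y * exp_prim D s + exp_cross s).
  have -> : c * (exp_prim T y * exp_prim D b + exp_cross b) = F b - F 0.
    by rewrite /F exp_prim0 exp_cross0 mulr0 addr0 mulr0 subr0.
  apply: (@Rintegral_FTC _ f F (fun s => c * (expR (T * s) * exp_prim D s +
    expR (D * s) * (exp_prim T y - exp_prim T s)))) => // [s|s|s /andP[s0 sb]].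
  - have -> : F = c \*: (exp_prim T y \*: exp_prim D + exp_cross) by [].
    have d := is_derive_exp_cross s.
    by apply: is_derive_eq; rewrite /GRing.scale /=; ring.
  - apply: cvgM; first exact: cvg_cst.
    apply: cvgD; apply: cvgM.
    + exact: continuous_expRM.
    + exact: continuous_exp_prim.
    + exact: continuous_expRM.
    + by apply: cvgB; [exact: cvg_cst|exact: continuous_exp_prim].
  - by rewrite fE ?s0 ?(le_trans sb) // /exp_kernel_section (le_trans sb).
case: (leP y x) => yx; last by have [] := below x (lexx x) (ltW yx) x0.
have [i1 e1] := below y yx (lexx y) y0.
have [i2 e2] : mu.-integrable `[y, x] (EFin \o f) /\
    \int[mu]_(s in `[y, x]) f s =
    (c * exp_prim D y) * (exp_prim T x - exp_prim T y).
  apply: Rintegral_expM_segment => // s /andP[ys sx].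
  rewrite fE ?sx ?(le_trans y0) // /exp_kernel_section.
  case: (leP s y) => sy; last by ring.
  have -> : s = y by apply/le_anti; rewrite sy.
  by ring.
have [_ ->] := Rintegral_itv_cat y0 yx i1 i2.
by rewrite e1 e2; ring.
Qed.

(* By Rolle's theorem the cross term is not proportional to exp_prim D: the
   quotient of their derivatives is injective since its own derivative is
   (T - D) e^((T - D) y) exp_prim D y. *)
Lemma exp_cross_indep y0 y1 : T != D -> 0 < y0 -> y0 < y1 ->
  exp_cross y0 * exp_prim D y1 != exp_cross y1 * exp_prim D y0.
Proof.
move=> TD y0_gt0 y01; apply/eqP => eq01.
have rolle (F g : R -> R) a b : (forall x : R, is_derive x 1 F (g x)) ->
    a < b -> F a = F b -> exists2 z, a < z < b & g z = 0.
  move=> dF ab Fab.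
  have [||z] := Rolle ab _ _ Fab.
  - by move=> x _; apply: ex_derive.
  - by apply: continuous_subspaceT; apply: is_derive1_continuous dF.
  - rewrite in_itv /= => zab dz; exists z => //.
    by rewrite -(@derive_val _ _ _ _ _ _ _ (dF z)) (@derive_val _ _ _ _ _ _ _ dz).
pose F y := exp_cross y * exp_prim D y1 - exp_cross y1 * exp_prim D y.
(* [w] is the quotient of the derivatives of [exp_cross] and [exp_prim D]. *)
pose w y := expR ((T - D) * y) * exp_prim D y - exp_prim T y.
have dF x : is_derive x 1 F
    (expR (D * x) * (w x * exp_prim D y1 - exp_cross y1)).
  have -> : F = exp_prim D y1 \*: exp_cross - exp_cross y1 \*: exp_prim D.
    by apply/funext => z /=; rewrite /F mulrC.
  have d := is_derive_exp_cross x.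
  apply: is_derive_eq; rewrite /GRing.scale /= /w.
  have -> : expR (T * x) = expR (D * x) * expR ((T - D) * x).
    by rewrite -expRD; congr expR; ring.
  by ring.
have dw x : is_derive x 1 w ((T - D) * expR ((T - D) * x) * exp_prim D x).
  have -> : w = (fun y => expR ((T - D) * y)) * exp_prim D - exp_prim T by [].
  apply: is_derive_eq; rewrite /GRing.scale /=.
  have -> : expR (T * x) = expR ((T - D) * x) * expR (D * x).
    by rewrite -expRD; congr expR; ring.
  by ring.
(* [F] vanishes at 0, [y0] and [y1], so its derivative has two zeros, at which [w] takes the same
   value; a third use of Rolle's theorem gives a positive zero of the derivative of [w], which is
   impossible. *)
have F0 : F 0 = 0 by rewrite /F exp_cross0 exp_prim0 mulr0 mul0r subrr.
have F1 : F y1 = 0 by rewrite /F subrr.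
have Fy0 : F y0 = 0 by rewrite /F eq01 subrr.
have prim_gt0 y : 0 < y -> 0 < exp_prim D y.
  by move=> y_gt0; rewrite -(exp_prim0 D) exp_prim_lt.
have wE z : expR (D * z) * (w z * exp_prim D y1 - exp_cross y1) = 0 ->
    w z = exp_cross y1 / exp_prim D y1.
  move=> /eqP; rewrite mulf_eq0 gt_eqF ?expR_gt0 //= subr_eq0 => /eqP <-.
  by rewrite mulfK // gt_eqF // prim_gt0 // (lt_trans y0_gt0).
have [z0 /andP[z0_gt0 z0_lt] /wE w0] := rolle _ _ _ _ dF y0_gt0 (etrans F0 (esym Fy0)).
have [z1 /andP[z1_gt z1_lt] /wE w1] := rolle _ _ _ _ dF y01 (etrans Fy0 (esym F1)).
have z01 : z0 < z1 := lt_trans z0_lt z1_gt.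
have [z /andP[z0z zz1] /eqP] := rolle _ _ _ _ dw z01 (etrans w0 (esym w1)).
rewrite !mulf_eq0 subr_eq0 (negbTE TD) gt_eqF ?expR_gt0 //=.
by rewrite gt_eqF // prim_gt0 // (lt_trans z0_gt0).
Qed.

End ExpKernel.

(** * Semiseparability from the generators f, h, g *)

Section ExtendedGenerators.
Variables (R : realType) (N : nat).
Variables (A : 'M[R]_N) (e f h g : 'I_N -> R).
Hypotheses (symA : A^T = A) (e0 : forall i, 0 < e i).
Hypothesis AE : forall i j : 'I_N, (j <= i)%N ->
  A i j = e i * e j * (f i * h j + g j).

Lemma extended_generators_semiseparable_le2 : semiseparable_le 2 A.
Proof.
split=> //; apply: (@lower_block_generators_le2 _ _ _
  (fun i => e i * f i) e (fun j => e j * h j) (fun j => e j * g j)).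
by move=> i j ji; rewrite AE //; ring.
Qed.

(** The minor on rows [i1], [i2] and columns [i0], [i1] factors into the increment of f and the
    determinant of (g, h), up to positive factors. *)
Lemma extended_generators_semiseparable2 (i0 i1 i2 : 'I_N) :
  (i0 < i1)%N -> (i1 < i2)%N -> f i1 != f i2 ->
  g i0 * h i1 != g i1 * h i0 -> semiseparable 2 A.
Proof.
move=> lt01 lt12 f12 gh; have semi := extended_generators_semiseparable_le2.
split=> //; exists i1; apply/eqP; rewrite eqn_leq semi.2 /=.
apply: (lower_block_minor2_ge2 lt01 lt12).
rewrite !AE ?(ltnW lt01) ?(ltnW lt12) ?(ltnW (ltn_trans lt01 lt12)) //.
rewrite [X in X != 0](_ : _ = e i0 * e i1 * e i1 * e i2 *
  ((f i2 - f i1) * (g i0 * h i1 - g i1 * h i0))); last by ring.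
rewrite mulf_neq0 //; first by rewrite gt_eqF // !mulr_gt0.
by rewrite mulf_neq0 // subr_eq0 // eq_sym.
Qed.

End ExtendedGenerators.

(** * The double sum of the kernel in discrete time *)

Section GeometricKernel.
Variables (R : fieldType) (p q : R).

Definition geo (x : R) n := \sum_(r < n) x ^+ r.

Definition geo_cross n := \sum_(s < n) (p ^+ s * geo q s - q ^+ s * geo p s).

Definition geo_kernel (s r : nat) :=
  if (r <= s)%N then p ^+ s * q ^+ r else q ^+ s * p ^+ r.

Lemma geoS x n : geo x n.+1 = geo x n + x ^+ n.
Proof. by rewrite /geo big_ord_recr. Qed.

Lemma geo_crossS n :
  geo_cross n.+1 = geo_cross n + (p ^+ n * geo q n - q ^+ n * geo p n).
Proof. by rewrite /geo_cross big_ord_recr. Qed.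

Lemma geo_kernelC s r : geo_kernel s r = geo_kernel r s.
Proof.
by rewrite /geo_kernel; case: (ltngtP r s) => [||->] //; rewrite mulrC.
Qed.

Lemma sum_geo_kernel_row s n : (n <= s.+1)%N ->
  \sum_(r < n) geo_kernel s r = p ^+ s * geo q n.
Proof.
move=> ns; rewrite /geo mulr_sumr; apply: eq_bigr => r _.
by rewrite /geo_kernel -ltnS (leq_trans (ltn_ord r)).
Qed.

(** Square sums grow by bordering: the new row and, by symmetry, the new column carry the factor
    [p ^+ k], and [geo_cross] corrects the increment of the product of the geometric sums
    accordingly. Each further row s adds [p ^+ s * geo q n]. *)
Lemma sum_geo_kernel m n : (n <= m)%N ->
  \sum_(s < m) \sum_(r < n) geo_kernel s r = geo p m * geo q n + geo_cross n.
Proof.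
have diag k : \sum_(s < k) \sum_(r < k) geo_kernel s r =
    geo p k * geo q k + geo_cross k.
  elim: k => [|k IH]; first by rewrite /geo /geo_cross !big_ord0 mul0r addr0.
  rewrite big_ord_recr /= sum_geo_kernel_row //.
  under eq_bigr do rewrite big_ord_recr /=.
  rewrite big_split /= IH.
  under [X in _ + X + _]eq_bigr do rewrite geo_kernelC.
  by rewrite sum_geo_kernel_row // geo_crossS !geoS; ring.
elim: m => [|m IH]; first by rewrite leqn0 => /eqP ->; exact: diag.
rewrite leq_eqVlt => /predU1P[->|]; first exact: diag.
rewrite ltnS => nm; rewrite big_ord_recr /= IH //.
by rewrite sum_geo_kernel_row ?(leq_trans nm) // geoS; ring.
Qed.

Lemma geoE x n : 1 - x != 0 -> geo x n = (1 - x ^+ n) / (1 - x).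
Proof.
by move=> x1; rewrite -[1 - x ^+ n]opprB subrX1 -mulNr opprB mulrC mulKf.
Qed.

Lemma geo_crossE n : 1 - p != 0 -> 1 - q != 0 -> 1 - p * q != 0 ->
  geo_cross n = (q ^+ n - p ^+ n + (q - p) / (1 - p * q) * (p ^+ n * q ^+ n - 1))
    / ((1 - q) * (1 - p)).
Proof.
move=> p1 q1 pq1; elim: n => [|n IH].
  by rewrite /geo_cross big_ord0 !expr0 mul1r !subrr mulr0 addr0 mul0r.
rewrite geo_crossS IH !geoE // !exprS.
by field; rewrite q1 p1 pq1.
Qed.

End GeometricKernel.

(** Here 2 and 3 are the numbers of terms at the first two sampling times; for these the determinant
    is an explicit polynomial with factor [p - q]. *)
Lemma geo_cross_indep (R : realFieldType) (p q : R) : 0 < p -> p < q ->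
  geo_cross p q 2 * geo q 3 != geo_cross p q 3 * geo q 2.
Proof.
move=> p0 pq; rewrite -subr_eq0.
rewrite !geo_crossS !geoS /geo_cross /geo !big_ord0.
rewrite [X in X != 0](_ : _ = - (p - q) * (q + p * (1 + q) ^+ 2)); last by ring.
rewrite mulf_neq0 //; first by rewrite oppr_eq0 subr_eq0 lt_eqF.
have q0 := lt_trans p0 pq.
by rewrite gt_eqF // addr_gt0 // mulr_gt0 // exprn_gt0 // addr_gt0.
Qed.

(** * Output kernels of the DC kernel with exponential input *)

Section DCKernel.
Variables (R : realType) (lambda rho alpha : R).
Hypotheses (lambda0 : 0 < lambda) (rho0 : 0 < rho).
Let T := ln (lambda * rho) + alpha.
Let D := ln (lambda / rho) + alpha.

(** The DC kernel is [lambda * rho] to the power max(s, r) times [lambda / rho] to the power min(s,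
    r); the growth of the shifted inputs in s and r adds [alpha] to both logarithms. *)
Lemma dc_kernel_exp_input x y s r :
  dc_kernel lambda rho s r * exp_input alpha (x - s) * exp_input alpha (y - r) =
  if (s <= x) && (r <= y)
  then expR (- alpha * x) * expR (- alpha * y) * exp_kernel T D s r else 0.
Proof.
rewrite /exp_input !subr_ge0; case: (leP s x) => _ /=; last by rewrite mulr0 mul0r.
case: (leP r y) => _; last by rewrite mulr0.
rewrite /dc_kernel /exp_kernel /T /D lnM ?posrE // ln_div ?posrE //.
rewrite /powR !gt_eqF // -!expRD.
by case: (leP r s) => rs; [rewrite ger0_norm ?subr_ge0 //|
  rewrite ltr0_norm ?subr_lt0 //]; rewrite -expRD; congr expR; ring.
Qed.

Lemma output_kernel_ctE N (t : 'I_N -> R) (i j : 'I_N) :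
  T != 0 -> D != 0 -> (forall k, 0 <= t k) ->
  output_kernel_ct (dc_kernel lambda rho) (exp_input alpha) t i j =
  expR (- alpha * t i) * expR (- alpha * t j) *
  (if t j <= t i
   then exp_prim T (t i) * exp_prim D (t j) + exp_cross T D (t j)
   else exp_prim T (t j) * exp_prim D (t i) + exp_cross T D (t i)).
Proof.
move=> T0 D0 t0; rewrite mxE.
apply: Rintegral_exp_kernel_section => // s.
- move=> /andP[s0 sx]; apply: Rintegral_exp_kernel => // r.
  + by move=> /andP[r0 ry]; rewrite dc_kernel_exp_input sx ry.
  + by move=> yr; rewrite dc_kernel_exp_input leNgt [r <= _]leNgt yr andbF.
- move=> xs; rewrite (_ : (fun r => _) = cst 0) /=; last first.
    by apply/funext => r; rewrite dc_kernel_exp_input leNgt xs.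
  by rewrite /Rintegral integral0.
Qed.

Lemma lim_series_finite (f : nat -> R) n : (forall k, (n <= k)%N -> f k = 0) ->
  \big[+%R/0]_(0 <= k <oo) f k = \sum_(k < n) f k.
Proof.
move=> f0; apply/cvg_lim => //; apply: cvg_near_cst; near=> m.
have nm : (n <= m)%N by near: m; exact: nbhs_infty_ge.
rewrite (big_cat_nat (n := n)) //= big_mkord -[RHS]addr0; congr (_ + _).
by rewrite big_nat_cond big1 // => k /andP[/andP[nk _] _]; exact: f0.
Unshelve. all: by end_near. Qed.

(** The sampling time of the 0-based index i is i + 1, so the delays 0, ..., i + 1 contribute, which
    are i + 2 terms. *)
Lemma output_kernel_dtE N (i j : 'I_N) :
  output_kernel_dt (dc_kernel lambda rho) (exp_input alpha)
    (fun k : 'I_N => k.+1%:R) i j =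
  expR (- alpha * i.+1%:R) * expR (- alpha * j.+1%:R) *
  \sum_(s < i.+2) \sum_(r < j.+2) geo_kernel (expR T) (expR D) s r.
Proof.
rewrite mxE (@lim_series_finite _ i.+2) => [|s si]; last first.
  rewrite (@lim_series_finite _ 0) ?big_ord0 // => r _.
  by rewrite dc_kernel_exp_input ler_nat leqNgt si.
rewrite mulr_sumr; apply: eq_bigr => s _.
rewrite (@lim_series_finite _ j.+2) => [|r rj]; last first.
  by rewrite dc_kernel_exp_input !ler_nat [(r <= _)%N]leqNgt rj andbF.
rewrite mulr_sumr; apply: eq_bigr => r _.
rewrite dc_kernel_exp_input !ler_nat !leq_ord /=; congr (_ * _).
rewrite /exp_kernel /geo_kernel ler_nat -!expRM_natl.
by case: ifP => _; rewrite -expRD; congr expR; ring.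
Qed.

End DCKernel.

(* A matrix of size N <= 2 has no block of rank 2, and the continuous-time
   matrix has a zero row and column at a sampling time 0; so the rank 2 of the
   definition of S_(N,2) is asserted when there are three positive sampling
   times, and the bound "rank <= 2" is asserted always.  The constants C and C'
   are defined only when ln lambda + alpha <> 0. *)
Theorem proposition3p4 (R : realType) (N : nat) (lambda rho alpha : R)
    (hlambda : 0 < lambda <= 1) (hrho : 0 < rho < 1) :
  let T := ln (lambda * rho) + alpha in
  let D := ln (lambda / rho) + alpha in
  T != 0 -> D != 0 ->
  (* continuous time *)
  (forall t : 'I_N -> R,
    (forall i, 0 <= t i) ->
    (forall i j : 'I_N, (i < j)%N -> t i < t j) ->
    let Psi :=
      output_kernel_ct (dc_kernel lambda rho) (exp_input alpha) t in
    let e j := expR (- alpha * t j) in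
    let m j := (lambda * rho) `^ t j - e j in
    let M := tail_sum (fun j => m j ^+ 2) in
    let E := tail_sum (fun j => expR (- 2 * alpha * t j)) in
    let C := ln rho / (ln lambda + alpha) in
    let c (i : 'I_N) :=
      vec2 (`|m i| / Num.sqrt (M i)) (e i / Num.sqrt (E i)) in
    let s (i : 'I_N) :=
      vec2 (Num.sqrt (M i.+1) / Num.sqrt (M i))
           (Num.sqrt (E i.+1) / Num.sqrt (E i)) in
    let nu (i : 'I_N) :=
      vec2 (`|(lambda / rho) `^ t i - e i| * Num.sqrt (M i) / `|D * T|)
           (((lambda / rho) `^ t i - (lambda * rho) `^ t i
             + C * (lambda `^ (2 * t i) * expR (alpha * t i) - e i))
            / (D * T) * Num.sqrt (E i)) in
    [/\ semiseparable_le 2 Psi,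
        (3 <= #|[pred i | (0 < t i)%R]|)%N -> semiseparable 2 Psi
      & ln lambda + alpha != 0 -> is_GvR Psi c s nu])
  /\
  (* discrete time *)
  (let t (i : 'I_N) : R := i.+1%:R in
    let Psi :=
      output_kernel_dt (dc_kernel lambda rho) (exp_input alpha) t in
    let e j := expR (- alpha * t j) in
    let m j := e j - (lambda * rho) `^ t j * expR T in
    let M := tail_sum (fun j => m j ^+ 2) in
    let E := tail_sum (fun j => expR (- 2 * alpha * t j)) in
    let T' := 1 - expR T in
    let D' := 1 - expR D in
    let C' := (expR D - expR T) / (1 - expR (D + T)) in
    let c (i : 'I_N) :=
      vec2 (`|m i| / Num.sqrt (M i)) (e i / Num.sqrt (E i)) in
    let s (i : 'I_N) :=
      vec2 (Num.sqrt (M i.+1) / Num.sqrt (M i))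
           (Num.sqrt (E i.+1) / Num.sqrt (E i)) in
    let nu (i : 'I_N) :=
      vec2 (`|e i - (lambda / rho) `^ t i * expR D| * Num.sqrt (M i)
            / `|D' * T'|)
           ((expR D * (lambda / rho) `^ t i - expR T * (lambda * rho) `^ t i
             + C' * (expR (D + T) * lambda `^ (2 * t i) * expR (alpha * t i)
                     - e i))
            / (D' * T') * Num.sqrt (E i)) in
    [/\ semiseparable_le 2 Psi,
        (3 <= N)%N -> semiseparable 2 Psi
      & ln lambda + alpha != 0 -> is_GvR Psi c s nu]).
Proof.
case/andP: hlambda => lambda0 _.
have rho0 : 0 < rho by case/andP: hrho.
move=> T D T0 D0.
have TE : T = ln lambda + ln rho + alpha by rewrite /T lnM ?posrE.
have DE : D = ln lambda - ln rho + alpha by rewrite /D ln_div ?posrE.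
have TD : T < D.
  by have := ln_lt0 hrho; rewrite TE DE; lra.
have powE (x y : R) : 0 < x -> x `^ y = expR (ln x * y).
  by move=> x0; rewrite /powR gt_eqF // mulrC.
have lrE y : (lambda * rho) `^ y = expR (- alpha * y) * expR (T * y).
  by rewrite powE ?mulr_gt0 // -expRD /T; congr expR; ring.
have ldE y : (lambda / rho) `^ y = expR (- alpha * y) * expR (D * y).
  by rewrite powE ?divr_gt0 // -expRD /D; congr expR; ring.
have l2E y : lambda `^ (2 * y) * expR (alpha * y) =
    expR (- alpha * y) * (expR (T * y) * expR (D * y)).
  by rewrite powE // -!expRD TE DE; congr expR; ring.
have TDE : T + D = 2 * (ln lambda + alpha) by rewrite TE DE; ring.
have exp1 (k : R) : k != 0 -> 1 - expR k != 0.
  by apply: contra_neq => /subr0_eq k1; rewrite -[k]expRK -k1 ln1.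
have e2E (y : R) : expR (- 2 * alpha * y) = expR (- alpha * y) ^+ 2.
  by rewrite expr2 -expRD; congr expR; ring.
split.
- move=> t t0 tmono Psi e m M E C c s nu.
  have tle (i j : 'I_N) : (j <= i)%N -> t j <= t i.
    by rewrite leq_eqVlt => /predU1P[/val_inj ->//|/tmono/ltW].
  have e0 i : 0 < e i by exact: expR_gt0.
  have symPsi : Psi^T = Psi.
    apply/matrixP => i j; rewrite mxE /Psi !output_kernel_ctE //.
    rewrite [X in X * _]mulrC; congr (_ * _).
    by case: (ltgtP (t i) (t j)) => [||->].
  have PsiE (i j : 'I_N) : (j <= i)%N -> Psi i j = e i * e j *
      (exp_prim T (t i) * exp_prim D (t j) + exp_cross T D (t j)).
    by move=> ji; rewrite /Psi output_kernel_ctE // tle.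
  have semi := extended_generators_semiseparable_le2 symPsi PsiE.
  have prim_ge0 k i : 0 <= exp_prim k (t i).
    by rewrite -(exp_prim0 k) ltW_homo //; exact: exp_prim_lt.
  split => //.
  + move=> pos3.
    have N3 : (3 <= N)%N.
      by apply: leq_trans pos3 _; rewrite -[X in (_ <= X)%N]card_ord max_card.
    (* The times increase, so three positive ones force the last three to be positive: if [t i0]
       were not, only [i1] and [i2] could be. *)
    have i0P : (N - 3 < N)%N by lia.
    have i1P : (N - 2 < N)%N by lia.
    have i2P : (N - 1 < N)%N by lia.
    pose i0 := Ordinal i0P; pose i1 := Ordinal i1P; pose i2 := Ordinal i2P.
    have lt01 : (i0 < i1)%N by rewrite /=; lia.
    have lt12 : (i1 < i2)%N by rewrite /=; lia.
    have ti0 : 0 < t i0.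
      rewrite ltNge; apply/negP => ti0; move: pos3; rewrite leqNgt ltnS => /negP.
      apply; apply: leq_trans (_ : #|pred2 i1 i2| <= 2)%N; last by rewrite card2; case: eqP.
      apply/subset_leq_card/fintype.subsetP => i; rewrite !inE => ti.
      have : (i0 < i)%N by rewrite ltnNge; apply/negP => /tle; lra.
      move=> /= i0i; have iN := ltn_ord i.
      have : i = i1 :> nat \/ i = i2 :> nat by rewrite /=; lia.
      by case=> /val_inj ->; rewrite eqxx ?orbT.
    apply: (extended_generators_semiseparable2 symPsi e0 PsiE lt01 lt12).
      by rewrite lt_eqF // exp_prim_lt // tmono.
    by apply: exp_cross_indep => //; [rewrite lt_eqF|exact: tmono].
  + move=> a0.
    (* Thus [m] and [n] are e f and e h up to the constants [T] and [D]; as f and h are nonnegative,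
       the absolute values affect only these constants, and dividing by [|D * T|] removes them. *)
    have mE i : m i = e i * (T * exp_prim T (t i)).
      by rewrite /m lrE exp_primE // -/(e i); field.
    pose n i := (lambda / rho) `^ t i - e i.
    have nE i : n i = e i * (D * exp_prim D (t i)).
      by rewrite /n ldE exp_primE // -/(e i); field.
    apply: (@GvR_of_generators _ _ Psi m n e _ _ `|D * T|) => // [i i_gt0|i j ji].
      have ti : 0 < t i.
        by rewrite (le_lt_trans (t0 (Ordinal (ltn_trans i_gt0 (ltn_ord i)))))
           // tmono.
      rewrite mE mulf_neq0 // ?mulf_neq0 // gt_eqF //.
      by rewrite -(exp_prim0 T) exp_prim_lt.
    rewrite PsiE // mE nE mulrDr; congr (_ + _).
      rewrite !normrM !(gtr0_norm (e0 _)) !(ger0_norm (prim_ge0 _ _)).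
      by field; rewrite !normr_eq0 T0.
    (* [C] is defined exactly when [T + D] is nonzero, which is also when [exp_prim (T + D)] is
       given by its quotient formula. *)
    have TD0 : T + D != 0 by rewrite TDE mulf_neq0 // pnatr_eq0.
    have -> : C = (T - D) / (T + D).
      by rewrite /C TDE TE DE; field.
    rewrite ldE lrE l2E /exp_cross !exp_primE // (mulrDl T D) expRD -/(e j).
    by field; rewrite T0 D0 TD0.
- move=> t Psi e m M E T' D' C' c s nu.
  have e0 i : 0 < e i by exact: expR_gt0.
  have T'0 : T' != 0 by exact: exp1.
  have D'0 : D' != 0 by exact: exp1.
  have PsiE (i j : 'I_N) : (j <= i)%N -> Psi i j = e i * e j *
      (geo (expR T) i.+2 * geo (expR D) j.+2 + geo_cross (expR T) (expR D) j.+2).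
    by move=> ji; rewrite /Psi output_kernel_dtE // sum_geo_kernel.
  have symPsi : Psi^T = Psi.
    apply/matrixP => i j; rewrite mxE /Psi !output_kernel_dtE // exchange_big.
    rewrite [X in X * _]mulrC; congr (_ * _).
    by apply: eq_bigr => k _; apply: eq_bigr => l _; rewrite geo_kernelC.
  have geo_gt0 (k : R) n : 0 < geo (expR k) n.+1.
    rewrite geoS ltr_wpDl ?exprn_gt0 ?expR_gt0 //.
    by apply: sumr_ge0 => l _; rewrite exprn_ge0 // expR_ge0.
  split => //.
  + exact: extended_generators_semiseparable_le2 symPsi PsiE.
  + move=> N3.
    have i1P : (1 < N)%N by exact: ltn_trans N3.
    have i0P : (0 < N)%N by exact: ltn_trans i1P.
    apply: (extended_generators_semiseparable2 symPsi e0 PsiE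
      (i0 := Ordinal i0P) (i1 := Ordinal i1P) (i2 := Ordinal N3)) => //=.
      by rewrite [X in _ != X]geoS lt_eqF // ltrDl exprn_gt0 // expR_gt0.
    by apply: geo_cross_indep; rewrite ?expR_gt0 ?ltr_expR.
  + move=> a0.
    (* The geometric sum has one term more than the value of [t i], which is where the extra factor
       [expR k] comes from. *)
    have geo_kE k i : 1 - expR k != 0 ->
        e i * (1 - expR k) * geo (expR k) i.+2 =
        e i - e i * expR (k * t i) * expR k.
      by move=> k0; rewrite geoE // /t expRM_natr exprSr; field.
    have mE i : m i = e i * (T' * geo (expR T) i.+2).
      by rewrite mulrA geo_kE // /m lrE.
    pose n i := e i - (lambda / rho) `^ t i * expR D.
    have nE i : n i = e i * (D' * geo (expR D) i.+2).
      by rewrite mulrA geo_kE // /n ldE.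
    apply: (@GvR_of_generators _ _ Psi m n e _ _ `|D' * T'|) => // [i _|i j ji].
      have := geo_gt0 T i.+1; have := e0 i; rewrite mE.
      by move=> /lt0r_neq0 ei /lt0r_neq0 gi; rewrite !mulf_neq0.
    rewrite PsiE // mE nE mulrDr; congr (_ + _).
      rewrite !normrM !(gtr0_norm (e0 _)) !(gtr0_norm (geo_gt0 _ _)).
      by field; rewrite !normr_eq0 T'0.
    (* This is the denominator of [C'], nonzero because [T + D] is; it permits the closed form of
       the cross sum. *)
    have TD0 : 1 - expR T * expR D != 0.
      by rewrite -expRD exp1 // TDE mulf_neq0 // pnatr_eq0.
    have powS k : expR (k * t j) * expR k = expR k ^+ j.+2.
      by rewrite [RHS]exprSr -expRM_natr.
    rewrite geo_crossE // /C' [D + T]addrC (expRD T D) ldE lrE.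
    rewrite -[expR T * _ * _ * _]mulrA l2E -/(e j) -!powS.
    by rewrite /D' /T'; field; rewrite T'0 D'0 TD0.
Qed.
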